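(* Let $A,B\in\mathcal{M}_n^+$ with $A\le B$ and let $0\le v\le 1$. Then $$\frac{v(1-v)}{2}(B-A)B^{-1}(B-A)\;\le\; A\nabla_v B-A\sharp_v B\;\le\;\frac{v(1-v)}{2}(B-A)A^{-1}(A!B)A^{-1}(B-A).$$
   Context: $\mathcal{M}_n^+$ denotes the set of positive (definite) $n\times n$ complex matrices: $A\in\mathcal{M}_n^+$ iff $\langle Ax,x\rangle>0$ for all nonzero $x\in\mathbb{C}^n$. For Hermitian matrices, $X\le Y$ means that $Y-X$ is positive semidefinite. For $A,B\in\mathcal{M}_n^+$ and $0\le v\le1$, $A\nabla_v B=(1-v)A+vB$ is the weighted arithmetic mean, $A\sharp_v B=A^{1/2}\left(A^{-1/2}BA^{-1/2}\right)^{v}A^{1/2}$ is the weighted geometric mean, and $A!B=\left(\frac{A^{-1}+B^{-1}}{2}\right)^{-1}$ is the harmonic mean. *)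

(* Defs.v *)
From mathcomp Require Import all_boot all_order all_algebra.
From mathcomp Require Import sesquilinear spectral.
From mathcomp Require Import complex.
From mathcomp Require Import reals exp.

Set Implicit Arguments.
Unset Strict Implicit.
Unset Printing Implicit Defensive.

Import Order.TTheory GRing.Theory Num.Theory.
Local Open Scope ring_scope.
Local Open Scope complex_scope.
Local Open Scope sesquilinear_scope.

Section MatrixMeans.
Variables (R : realType) (n : nat).
Implicit Types (A B X Y : 'M[R[i]]_n) (v p : R).

(* <A x, x> = x^* A x, linear in the first argument of < , >. *)
Definition qform A (x : 'cV[R[i]]_n) : R[i] := (x^t* *m A *m x) 0 0.

(* The order of R[i] is partial: [0 < z] (resp. [0 <= z]) entails that z is
   real. *)
Definition posdefmx A : Prop :=
  forall x : 'cV[R[i]]_n, x != 0 -> 0 < qform A x.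
Definition possemidefmx A : Prop :=
  forall x : 'cV[R[i]]_n, 0 <= qform A x.

Definition loewner X Y : Prop :=
  [/\ X \is hermsymmx, Y \is hermsymmx & possemidefmx (Y - X)].

(* Real power of a positive definite matrix, by functional calculus: if
   A = U^-1 diag(d) U with U unitary, then A^p = U^-1 diag(d^p) U.  [spectralmx]
   and [spectral_diag] give such a decomposition of any normal matrix; for a
   positive definite A the entries of d are real and positive. *)
Definition powmx A p : 'M[R[i]]_n :=
  invmx (spectralmx A)
    *m diag_mx (map_mx (fun d : R[i] => (powR (complex.Re d) p)%:C)
                       (spectral_diag A))
    *m spectralmx A.

Definition amean v A B : 'M[R[i]]_n := (1 - v)%:C *: A + v%:C *: B.

Definition gmean v A B : 'M[R[i]]_n :=
  let Ah := powmx A (2^-1) in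
  let Amh := powmx A (- 2^-1) in
  Ah *m powmx (Amh *m B *m Amh) v *m Ah.

Definition hmean A B : 'M[R[i]]_n :=
  invmx (2^-1 *: (invmx A + invmx B)).

End MatrixMeans.

(* Main.v *)
(* With A = W^* W and B = W^* diag(s) W, where s >= 1 because A <= B, each of
   the three matrices is W^* diag(f(s)) W, so the claim reduces to the scalar
   case A = 1, B = t >= 1.  The scalar bounds are equalities at t = 1, and
   comparing derivatives leaves Bernoulli inequalities for t^(v-1). *)
Require Import Defs.
From mathcomp Require Import all_boot all_order all_algebra.
From mathcomp Require Import complex reals.
From mathcomp Require Import sesquilinear spectral.
From mathcomp Require Import classical_sets functions topology normedtype.
From mathcomp Require Import derive realfun exp ring lra.

Set Implicit Arguments.
Unset Strict Implicit.
Unset Printing Implicit Defensive.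

Import Order.TTheory GRing.Theory Num.Theory.
Import numFieldNormedType.Exports.
Local Open Scope ring_scope.
Local Open Scope complex_scope.
Local Open Scope sesquilinear_scope.

(** * Scalar inequalities for real powers *)

Lemma ge1_is_derive_ge0_le (R : realType) (f f' : R -> R) (t : R) :
    (forall x : R, 1 <= x -> is_derive x 1 f (f' x)) ->
    (forall x : R, 1 <= x -> 0 <= f' x) ->
  1 <= t -> f 1 <= f t.
Proof.
move=> df f'0 t1.
apply: (@ger0_derive1_le_cc _ f 1 t) => //.
- by move=> x; rewrite in_itv/= => /andP[/ltW/df[]].
- move=> x; rewrite in_itv/= => /andP[/ltW x1 _].
  by have /@derive_val dx := df x x1; rewrite derive1E dx f'0.
- apply: derivable_within_continuous => x; rewrite in_itv/= => /andP[/df[] //].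
- by rewrite in_itv/= lexx t1.
- by rewrite in_itv/= lexx t1.
Qed.

Lemma ln_leB1 (R : realType) (x : R) : 0 < x -> ln x <= x - 1.
Proof.
move=> x0; have -> : ln x = ln (1 + (x - 1)) by congr ln; ring.
by apply: le_ln1Dx; lra.
Qed.

(* Concavity of the logarithm, used at the tangent point [1 + a * (x - 1)]. *)
Lemma powR_Bernoulli (R : realType) (a x : R) :
  0 <= a <= 1 -> 0 < x -> x `^ a <= 1 + a * (x - 1).
Proof.
move=> /andP[a0 a1] x0.
have m0 : 0 < 1 + a * (x - 1).
  have [xle1|x1] := leP x 1; last by nra.
  have : 0 <= (1 - a) * (1 - x) by rewrite mulr_ge0; lra.
  lra.
set m := 1 + _ in m0 *.
have xm0 : 0 < x / m by rewrite divr_gt0.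
have im0 : 0 < m^-1 by rewrite invr_gt0.
rewrite -ler_ln ?posrE ?powR_gt0// ln_powR.
have h1 := ler_wpM2l a0 (ln_leB1 xm0).
have a1' : 0 <= 1 - a by lra.
have h2 := ler_wpM2l a1' (ln_leB1 im0).
rewrite ln_div ?posrE// in h1; rewrite lnV ?posrE// in h2.
(* [m] is the mean of [x] and [1] with weights [a] and [1 - a], so the right-hand sides of [h1] and
   [h2] cancel. *)
have e : a * (x / m - 1) + (1 - a) * (m^-1 - 1) = 0.
  by rewrite /m; field; rewrite gt_eqF.
lra.
Qed.

(** The tangent to [expR] at [0] gives the lower bound [1 + a * ln x]; since [a <= 0], multiplying
    [ln x <= x - 1] by [a] reverses it. *)
Lemma powR_Bernoulli_neg (R : realType) (a x : R) :
  a <= 0 -> 1 <= x -> 1 + a * (x - 1) <= x `^ a.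
Proof.
move=> a0 x1.
have x0 : 0 < x by lra.
rewrite /powR gt_eqF//; apply: le_trans (expR_ge1Dx _).
have := ler_wnM2l a0 (ln_leB1 x0); lra.
Qed.

(** The derivative of the difference of the two sides is [v] times the gap in Bernoulli's inequality
    for the exponent [v - 1 <= 0]. *)
Lemma amean_sub_gmean_le (R : realType) (v t : R) :
  0 <= v <= 1 -> 1 <= t ->
  1 - v + v * t - t `^ v <= v * (1 - v) / 2 * (t - 1) ^+ 2.
Proof.
move=> /andP[v0 v1] t1.
pose f (x : R) : R := v * (1 - v) / 2 * (x - 1) ^+ 2 - (1 - v + v * x) + x `^ v.
pose f' (x : R) : R := v * (x `^ (v - 1) - (1 + (v - 1) * (x - 1))).
suff: f 1 <= f t by rewrite /f powR1 subrr expr0n/=; lra.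
apply: (@ge1_is_derive_ge0_le _ f f' t _ _ t1) => x x1.
  have x0 : 0 < x by lra.
  have id1 := is_derive_id x (1 : R).
  have cst1 (k : R) := is_derive_cst k x (1 : R).
  have sq := is_deriveM (is_deriveB id1 (cst1 1)) (is_deriveB id1 (cst1 1)).
  have lin := is_deriveD (cst1 (1 - v)) (is_deriveZ v id1).
  have df := is_deriveD (is_deriveB (is_deriveZ (v * (1 - v) / 2) sq) lin)
                        (is_derive1_powR v x0).
  apply: (is_derive_eq df); rewrite /f' /GRing.scale/= !fctE/=; lra.
rewrite /f' mulr_ge0// subr_ge0 powR_Bernoulli_neg//; lra.
Qed.

Lemma amean_sub_gmean_ge (R : realType) (v t : R) :
  0 <= v <= 1 -> 1 <= t ->
  v * (1 - v) / 2 * ((t - 1) ^+ 2 / t) <= 1 - v + v * t - t `^ v.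
Proof.
move=> /andP[v0 v1] t1.
(* The quotient [(x - 1) ^+ 2 / x] is expanded as [x - 2 + x^-1] to ease differentiation. *)
pose f (x : R) : R := 1 - v + v * x - x `^ v - v * (1 - v) / 2 * (x - 2 + x^-1).
pose f' (x : R) : R := v * (1 - x `^ (v - 1) - (1 - v) / 2 * (1 - x^-1 ^+ 2)).
suff: f 1 <= f t.
  rewrite /f powR1.
  have -> : (t - 1) ^+ 2 / t = t - 2 + t^-1 by field; apply/eqP; lra.
  by rewrite invr1; lra.
apply: (@ge1_is_derive_ge0_le _ f f' t _ _ t1) => x x1.
  have x0 : 0 < x by lra.
  have xn0 : x != 0 by rewrite gt_eqF.
  have id1 := is_derive_id x (1 : R).
  have cst1 (k : R) := is_derive_cst k x (1 : R).
  have lin := is_deriveD (cst1 (1 - v)) (is_deriveZ v id1).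
  have frac := is_deriveD (is_deriveB id1 (cst1 2)) (is_deriveV xn0 id1).
  have df := is_deriveB (is_deriveB lin (is_derive1_powR v x0))
                        (is_deriveZ (v * (1 - v) / 2) frac).
  apply: (is_derive_eq df); rewrite /f' /GRing.scale/= exprVn; lra.
have x0 : 0 < x by lra.
rewrite /f' mulr_ge0//.
have y0 : 0 < x^-1 by rewrite invr_gt0.
have y1 : x^-1 <= 1 by rewrite invf_le1.
(* Passing to [x^-1] makes the exponent [1 - v] lie in [[0, 1]], the range of the concave Bernoulli
   inequality. *)
have -> : x `^ (v - 1) = x^-1 `^ (1 - v).
  by rewrite -powR_inv1 ?ltW// -powRrM; congr powR; ring.
have := @powR_Bernoulli R (1 - v) x^-1 _ y0.
have -> : 0 <= 1 - v <= 1 by lra.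
move=> /(_ isT).
(* With [y = x^-1], half of this term equals [(1 - v) * (1 - y) - (1 - v) / 2 * (1 - y ^+ 2)], the
   lower bound that Bernoulli leaves. *)
have : 0 <= (1 - v) * (1 - x^-1) ^+ 2 by rewrite mulr_ge0 ?sqr_ge0; lra.
lra.
Qed.

(** * Products, adjoints and unitary matrices *)

Lemma mulmx_cancel_middle (T : pzRingType) n (P D Q P' E Q' : 'M[T]_n) :
    Q *m P' = 1%:M ->
  (P *m D *m Q) *m (P' *m E *m Q') = P *m (D *m E) *m Q'.
Proof. by move=> QP'; rewrite -!mulmxA (mulmxA Q) QP' mul1mx. Qed.

Lemma trmxC_mul (C : numClosedFieldType) m n p
  (X : 'M[C]_(m, n)) (Y : 'M[C]_(n, p)) : (X *m Y)^t* = Y^t* *m X^t*.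
Proof. by rewrite trmx_mul map_mxM. Qed.

Lemma mulmx_trmxC_eq1 (C : numClosedFieldType) n (W V : 'M[C]_n) :
  W *m V^t* = 1%:M -> V *m W^t* = 1%:M.
Proof. by move=> WV; rewrite -[V]trmxCK -trmxC_mul WV trmx1 map_mx1. Qed.

Lemma hermsymmxP (C : numClosedFieldType) n (A : 'M[C]_n) :
  reflect (A^t* = A) (A \is hermsymmx).
Proof.
apply: (iffP (is_hermitianmxP _ _ _)); rewrite expr0 scale1r; exact: esym.
Qed.

(** Applying [U] recovers the basis vector. These are the eigenvectors at which quadratic forms get
    tested. *)
Lemma unitarymx_col_neq0 (C : numClosedFieldType) n (U : 'M[C]_n) i :
  U \is unitarymx -> U^t* *m delta_mx i 0 != 0 :> 'cV_n.
Proof.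
move=> /unitarymxP uU; apply/eqP => /(congr1 (mulmx U)).
rewrite mulmxA uU mul1mx mulmx0 => /matrixP/(_ i 0)/eqP.
by rewrite !mxE !eqxx oner_eq0.
Qed.

(** * Matrices congruent to real diagonal ones *)

Section Congruence.
Variables (R : realType) (n : nat).
Implicit Types (A B W V U X : 'M[R[i]]_n) (d e f : 'I_n -> R).

(** Allowing any [W], unitary or not, lets one [W] serve [A], [B] and their means at once; real
    entries can be compared by the scalar bounds. *)
Definition congdiag W d : 'M[R[i]]_n :=
  W^t* *m diag_mx (\row_i (d i)%:C) *m W.

Lemma congdiagE W (D : 'rV[R[i]]_n) d : (forall i, D 0 i = (d i)%:C) ->
  W^t* *m diag_mx D *m W = congdiag W d.
Proof.
move=> Dd; rewrite /congdiag; suff <- : D = \row_i (d i)%:C by [].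
by apply/rowP => i; rewrite Dd mxE.
Qed.

Lemma eq_congdiag W d e : d =1 e -> congdiag W d = congdiag W e.
Proof. by move=> de; apply: congdiagE => i; rewrite mxE de. Qed.

Lemma congdiag_herm W d : congdiag W d \is hermsymmx.
Proof.
apply/hermsymmxP.
rewrite /congdiag !trmxC_mul trmxCK mulmxA tr_diag_mx map_diag_mx.
by apply: congdiagE => i; rewrite !mxE; exact: conjc_real.
Qed.

Lemma congdiagD W d e :
  congdiag W d + congdiag W e = congdiag W (fun i => d i + e i).
Proof.
rewrite /congdiag -mulmxDl -mulmxDr -linearD /=.
by apply: congdiagE => i; rewrite !mxE (rmorphD (real_complex R)).
Qed.

Lemma congdiagZ W d (k : R) :
  k%:C *: congdiag W d = congdiag W (fun i => k * d i).
Proof.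
rewrite /congdiag scalemxAl scalemxAr -linearZ /=.
by apply: congdiagE => i; rewrite !mxE (rmorphM (real_complex R)).
Qed.

Lemma congdiagB W d e :
  congdiag W d - congdiag W e = congdiag W (fun i => d i - e i).
Proof.
rewrite -scaleN1r -(rmorphN1 (real_complex R)) congdiagZ congdiagD.
by apply: eq_congdiag => i; rewrite mulN1r.
Qed.

Lemma congdiag1 W : congdiag W (fun=> 1) = W^t* *m W.
Proof.
rewrite -[in RHS](mulmx1 (W^t*)) -diag_const_mx.
by apply/esym/congdiagE => i; rewrite mxE.
Qed.

Lemma congdiag_congr X W d : X^t* *m congdiag W d *m X = congdiag (W *m X) d.
Proof. by rewrite /congdiag trmxC_mul !mulmxA. Qed.

(** [V] is the inverse adjoint of [W], so both inner factors [W *m V^t*] and [V *m W^t*] cancel. *)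
Lemma congdiag_mul3 W V d e f : W *m V^t* = 1%:M ->
  congdiag W d *m congdiag V e *m congdiag W f =
  congdiag W (fun i => d i * e i * f i).
Proof.
move=> WV; rewrite /congdiag (mulmx_cancel_middle _ _ _ _ WV) mulmx_diag.
rewrite (mulmx_cancel_middle _ _ _ _ (mulmx_trmxC_eq1 WV)) mulmx_diag.
by apply: congdiagE => i; rewrite !mxE !(rmorphM (real_complex R)).
Qed.

(** As [V^t*] is the inverse of [W], inversion exchanges the frames [W] and [V]. *)
Lemma invmx_congdiag W V d : W *m V^t* = 1%:M -> (forall i, d i != 0) ->
  invmx (congdiag W d) = congdiag V (fun i => (d i)^-1).
Proof.
move=> WV d0.
have E : congdiag W d *m congdiag V (fun i => (d i)^-1) = 1%:M.
  rewrite /congdiag (mulmx_cancel_middle _ _ _ _ WV) mulmx_diag.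
  rewrite (_ : diag_mx _ = 1%:M).
    by rewrite mulmx1 (mulmx1C (mulmx_trmxC_eq1 WV)).
  rewrite -diag_const_mx; congr diag_mx; apply/rowP => i; rewrite !mxE.
  by rewrite -(rmorphM (real_complex R)) divff.
have [u _] := mulmx1_unit E.
by rewrite -[RHS](mulKmx u) E mulmx1.
Qed.

Lemma qform_congdiag W d (x : 'cV[R[i]]_n) :
  qform (congdiag W d) x = \sum_i (d i)%:C * `|(W *m x) i 0| ^+ 2.
Proof.
rewrite /qform /congdiag !mulmxA -trmxC_mul -mulmxA; move: (W *m x) => y.
rewrite mxE; apply: eq_bigr => i _.
by rewrite mul_mx_diag !mxE normCK mulrAC mulrC; congr (_ * _); exact: mulrC.
Qed.

(** The quadratic form of the difference is a sum of squared moduli with weights [e i - d i]. This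
    carries scalar bounds over to matrices. *)
Lemma loewner_congdiag W d e : (forall i, d i <= e i) ->
  loewner (congdiag W d) (congdiag W e).
Proof.
move=> de; split; [exact: congdiag_herm.. | move=> x].
rewrite congdiagB qform_congdiag sumr_ge0// => i _.
by rewrite mulr_ge0 ?exprn_ge0// ler0c subr_ge0.
Qed.

Lemma qform_congdiag_row U d i : U \is unitarymx ->
  qform (congdiag U d) (U^t* *m delta_mx i 0) = (d i)%:C.
Proof.
move=> /unitarymxP uU; rewrite qform_congdiag mulmxA uU mul1mx.
rewrite (bigD1 i)//= mxE !eqxx normr1 expr1n mulr1 big1 ?addr0// => j ji.
by rewrite mxE (negPf ji) normr0 expr0n mulr0.
Qed.

(** A Hermitian matrix is normal with real spectrum, so the real parts taken in [powmx] lose nothing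
    and one [d] serves [A] and all its powers. *)
Lemma spectral_congdiag A : A \is hermsymmx ->
  exists d, A = congdiag (spectralmx A) d /\
    forall p, powmx A p = congdiag (spectralmx A) (fun i => d i `^ p).
Proof.
move=> hA; exists (fun i => complex.Re (spectral_diag A 0 i)).
have uU := spectral_unitarymx A; split=> [|p]; last first.
  rewrite /powmx (invmx_unitary uU).
  by apply: congdiagE => i; rewrite mxE.
have /orthomx_spectralP {1}-> := hermitian_normalmx hA.
rewrite (invmx_unitary uU); apply: congdiagE => i; rewrite RRe_real//.
exact: mxOverP (hermitian_spectral_diag_real hA) _ _.
Qed.

Lemma qform_mul A X x : qform (X^t* *m A *m X) x = qform A (X *m x).
Proof. by rewrite /qform trmxC_mul !mulmxA. Qed.

(** Powers of [A] share an eigenbasis, so they multiply entrywise and the exponents add up to [1] or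
    [0]. *)
Lemma powmx_half A : A \is hermsymmx -> posdefmx A ->
  [/\ powmx A 2^-1 \is hermsymmx, powmx A (- 2^-1) \is hermsymmx,
      powmx A 2^-1 *m powmx A 2^-1 = A &
      powmx A 2^-1 *m powmx A (- 2^-1) = 1%:M].
Proof.
move=> hA pA; have [d [AE powE]] := spectral_congdiag hA.
have uU := spectral_unitarymx A; set U := spectralmx A in AE powE uU.
clearbody U.
(* Each eigenvalue is the value of the form at its eigenvector. *)
have d0 i : 0 < d i.
  have := pA _ (unitarymx_col_neq0 i uU).
  by rewrite AE qform_congdiag_row// ltcR.
have mulU e f : congdiag U e *m congdiag U f = congdiag U (fun i => e i * f i).
  rewrite /congdiag (mulmx_cancel_middle _ _ _ _ (unitarymxP uU)) mulmx_diag.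
  by apply: congdiagE => i; rewrite !mxE (rmorphM (real_complex R)).
rewrite !powE; split; rewrite ?congdiag_herm// mulU.
  rewrite [RHS]AE; apply: eq_congdiag => i.
  rewrite -powRD; last by rewrite (gt_eqF (d0 i)) implybT.
  have -> : 2^-1 + 2^-1 = 1 :> R by lra.
  by rewrite powRr1// ltW.
rewrite (@eq_congdiag _ _ (fun=> 1)).
  by rewrite congdiag1 (mulmx1C (unitarymxP uU)).
by move=> i; rewrite -powRD ?subrr ?powRr0// (gt_eqF (d0 i)) implybT.
Qed.

(* Simultaneous diagonalization by congruence: with [V] the unitary matrix
   diagonalizing [A^(-1/2) B A^(-1/2)], take [W = V A^(1/2)]. *)
Lemma congdiag_pair A B : posdefmx A -> loewner A B ->
  exists W V (s : 'I_n -> R), [/\ W *m V^t* = 1%:M, forall i, 1 <= s i,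
    A = congdiag W (fun=> 1), B = congdiag W s &
    forall v, gmean v A B = congdiag W (fun i => s i `^ v)].
Proof.
move=> pA [hA hB leAB].
have [/hermsymmxP hH /hermsymmxP hK HH HK] := powmx_half hA pA.
rewrite /gmean.
set H := powmx A 2^-1 in hH HH HK *; set K := powmx A (- 2^-1) in hK HK *.
clearbody H K; have KH := mulmx1C HK.
have hT : K *m B *m K \is hermsymmx.
  by apply/hermsymmxP; rewrite !trmxC_mul hK (hermsymmxP _ hB) mulmxA.
have [s [TE powE]] := spectral_congdiag hT.
have uU := spectral_unitarymx (K *m B *m K).
set U := spectralmx _ in TE powE uU; clearbody U.
have UU := unitarymxP uU.
(* The diagonalizing unitary is [U]; the witness [V = U K] is the inverse adjoint of [W = U H],
   because [H] and [K] are Hermitian and mutually inverse. *)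
exists (U *m H), (U *m K), s; split.
- by rewrite trmxC_mul hK !mulmxA -(mulmxA _ H) HK mulmx1.
(* At this vector the form of [B - A] becomes that of [K B K - 1] at an eigenvector, with value
   [s i - 1]. *)
- move=> i; have := leAB (K *m (U^t* *m delta_mx i 0)).
  rewrite -qform_mul hK mulmxBr mulmxBl TE.
  rewrite -HH !mulmxA KH mul1mx HK -(mulmx1C UU) -congdiag1 congdiagB.
  by rewrite qform_congdiag_row// ler0c subr_ge0.
- by rewrite -congdiag_congr congdiag1 (mulmx1C UU) hH mulmx1 HH.
- by rewrite -congdiag_congr -TE hH !mulmxA HK mul1mx -mulmxA KH mulmx1.
- by move=> v; rewrite powE -congdiag_congr hH.
Qed.

End Congruence.

Theorem theorem2p2 (R : realType) (n : nat) (A B : 'M[R[i]]_n) (v : R)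
  (hA : posdefmx A) (hB : posdefmx B) (hAB : loewner A B)
  (hv : 0 <= v <= 1) :
  loewner ((v * (1 - v) / 2)%:C *: ((B - A) *m invmx B *m (B - A)))
          (amean v A B - gmean v A B)
  /\
  loewner (amean v A B - gmean v A B)
          ((v * (1 - v) / 2)%:C *:
             ((B - A) *m invmx A *m hmean A B *m invmx A *m (B - A))).
Proof.
have [W [V [s [WV s1 AE BE gE]]]] := congdiag_pair hA hAB.
have s0 i : 0 < s i by apply: lt_le_trans (s1 i).
have sn0 i : s i != 0 by rewrite gt_eqF.
have one0 : forall i : 'I_n, (1 : R) != 0 by move=> _; rewrite oner_neq0.
have iA : invmx A = congdiag V (fun=> 1^-1).
  by rewrite AE (invmx_congdiag WV one0).
have iB : invmx B = congdiag V (fun i => (s i)^-1).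
  by rewrite BE (invmx_congdiag WV sn0).
have BA : B - A = congdiag W (fun i => s i - 1) by rewrite AE BE congdiagB.
(* These are the entries of the averaged inverses in the frame [V]; inverting once more returns to
   [W]. *)
pose h i : R := 2^-1 * (1^-1 + (s i)^-1).
have h0 i : 0 < h i by rewrite mulr_gt0 ?invr_gt0 ?addr_gt0 ?invr_gt0.
have hE : hmean A B = congdiag W (fun i => (h i)^-1).
  have half : 2^-1 = (2^-1)%:C :> R[i] by rewrite fmorphV rmorph_nat.
  rewrite /hmean half iA iB congdiagD congdiagZ.
  by apply: invmx_congdiag (mulmx_trmxC_eq1 WV) _ => i; rewrite gt_eqF ?h0.
have mE : amean v A B - gmean v A B =
    congdiag W (fun i => (1 - v) * 1 + v * s i - s i `^ v).
  by rewrite gE /amean {1}AE {1}BE !congdiagZ congdiagD congdiagB.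
split; rewrite mE BA.
  rewrite iB (congdiag_mul3 _ _ _ WV) congdiagZ.
  apply: loewner_congdiag => i; have := amean_sub_gmean_ge hv (s1 i).
  by rewrite mulr1 (mulrAC _ (s i)^-1) -expr2.
(* The five factors alternate between the frames [W] and [V], so the triple product rule applies
   twice. *)
rewrite iA hE !(congdiag_mul3 _ _ _ WV) congdiagZ.
apply: loewner_congdiag => i; rewrite mulr1 invr1 !mulr1.
(* It remains to insert the factor [(h i)^-1], the harmonic mean of [1] and [s i], which is at least
   [1] because [s i >= 1]. *)
apply: le_trans (amean_sub_gmean_le hv (s1 i)) _.
move: hv => /andP[v0 v1].
apply: ler_wpM2l; first by rewrite divr_ge0 ?mulr_ge0 ?subr_ge0.
rewrite mulrAC -expr2 ler_peMr ?sqr_ge0// invf_ge1// /h invr1 ler_pdivrMl//.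
by rewrite mulr1 lerD2l invf_le1.
Qed.
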